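(* $\mathfrak{S}_1(\mathrm{A},\mathrm{D})=\mathfrak{S}_1=\{1\}$, and $\mathfrak{S}_n(\mathrm{A},\mathrm{D})=\varnothing$ for all $n\ge 2$.
   Context: $\mathfrak{S}_n$ is the set of permutations $\sigma=\sigma_1\sigma_2\cdots\sigma_n$ of $[n]=\{1,\dots,n\}$ in one-line notation. A mesh pattern is a pair $p=(\pi,R)$ with $\pi\in\mathfrak{S}_m$ and $R\subseteq\{0,\dots,m\}\times\{0,\dots,m\}$ (the set of shaded unit cells, each given by its bottom-left corner, in the grid with dots at $(i,\pi_i)$). An occurrence of $p$ in $\sigma\in\mathfrak{S}_n$ is a choice of indices $i_1<\cdots<i_m$ such that $\sigma_{i_1}\cdots\sigma_{i_m}$ is order-isomorphic to $\pi$ and, for every $(a,b)\in R$, there is no index $r$ with $i_a<r<i_{a+1}$ and $v_b<\sigma_r<v_{b+1}$; here $v_1<\cdots<v_m$ is the increasing rearrangement of $\sigma_{i_1},\dots,\sigma_{i_m}$, $i_0=v_0=0$ and $i_{m+1}=v_{m+1}=n+1$. $\mathfrak{S}_n(p,q)$ is the set of permutations in $\mathfrak{S}_n$ with no occurrence of $p$ and no occurrence of $q$. The mesh patterns: $\mathrm{A}=(12,\{(0,2),(2,0)\})$ and $\mathrm{D}=(21,\{(0,0),(2,2)\})$. *)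

(* Defs.v *)
From mathcomp Require Import all_boot all_fingroup.

Set Implicit Arguments.
Unset Strict Implicit.
Unset Printing Implicit Defensive.

(* A permutation of [n] in one-line notation is an element s of 'S_n, which
   permutes {0, ..., n-1}: the 1-based letter at the 1-based position i.+1
   is (s i).+1. *)

Record mesh_pattern (m : nat) := MeshPattern {
  mesh_perm : 'S_m;
  mesh_shading : {set 'I_m.+1 * 'I_m.+1}
}.

Section Occurrences.
Variables (m n : nat) (p : mesh_pattern m) (s : 'S_n).
Implicit Types (e : {ffun 'I_m -> 'I_n}) (c : 'I_m.+1 * 'I_m.+1).

(* i_0 = 0, i_1, ..., i_m, i_(m+1) = n+1, 1-based; e j is i_(j+1) - 1. *)
Definition occ_positions e : seq nat :=
  0 :: rcons [seq (e j).+1 | j <- enum 'I_m] n.+1.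

(* v_0 = 0, v_1 < ... < v_m, v_(m+1) = n+1, 1-based. *)
Definition occ_values e : seq nat :=
  0 :: rcons (sort leq [seq (s (e j)).+1 | j <- enum 'I_m]) n.+1.

Definition in_cell e c (r : 'I_n) : bool :=
  [&& nth 0 (occ_positions e) c.1 < r.+1,
      r.+1 < nth 0 (occ_positions e) c.1.+1,
      nth 0 (occ_values e) c.2 < (s r).+1
    & (s r).+1 < nth 0 (occ_values e) c.2.+1].

Definition is_occurrence e : bool :=
  [&& [forall j : 'I_m, forall k : 'I_m, (j < k) ==> (e j < e k)],
      [forall j : 'I_m, forall k : 'I_m,
         (s (e j) < s (e k)) == (mesh_perm p j < mesh_perm p k)]
    & [forall c in mesh_shading p, ~~ [exists r : 'I_n, in_cell e c r]]].

Definition avoids : bool :=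
  ~~ [exists e : {ffun 'I_m -> 'I_n}, is_occurrence e].

End Occurrences.

Definition avoiders (m1 m2 n : nat) (p : mesh_pattern m1) (q : mesh_pattern m2)
  : {set 'S_n} := [set s : 'S_n | avoids p s && avoids q s].

(* In 'I_3, ord0 is 0 and ord_max is 2; the permutation 12 is the identity of
   'S_2 and 21 is the transposition of its two points. *)
Definition mesh_A : mesh_pattern 2 :=
  MeshPattern 1%g [set (ord0, ord_max); (ord_max, ord0)].

Definition mesh_D : mesh_pattern 2 :=
  MeshPattern (tperm ord0 ord_max) [set (ord0, ord0); (ord_max, ord_max)].

(* Main.v *)
Require Import Defs.
From mathcomp Require Import all_boot all_fingroup.

(** In a permutation of length at least 2, consider the first and the last
    letters.  They form the pattern 12 or the pattern 21.  All the cells shaded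
    in A and in D lie in the outer columns 0 and 2, that is, strictly to the
    left of the first chosen letter or strictly to the right of the second one;
    no position is left there, so the two end letters are an occurrence of A if
    they increase ([endpoints_occurrence] for 12) and of D otherwise.  For
    length 1 there is no room for two increasing positions, so every pattern of
    length 2 is avoided ([avoids_length1]). *)

Set Implicit Arguments.
Unset Strict Implicit.
Unset Printing Implicit Defensive.

Definition endpoints k : {ffun 'I_2 -> 'I_k.+2} :=
  [ffun j => if j == ord0 then ord0 else ord_max].

Lemma ord2_cases (j : 'I_2) : j = ord0 \/ j = ord_max.
Proof.
by case: j => [[|[|//]] lt_j2]; [left | right]; apply: val_inj.
Qed.

Lemma occ_positions_endpoints k :
  occ_positions (endpoints k) = [:: 0; 1; k.+2; k.+3].
Proof. by rewrite /occ_positions !enum_ordSl enum_ord0 /= !ffunE. Qed.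

(** Outside the middle column, the cells of the grid cut out by the two end
    letters contain no position, whatever their row. *)
Lemma in_cell_endpoints k (s : 'S_k.+2) (c : 'I_3 * 'I_3) (r : 'I_k.+2) :
  val c.1 != 1 -> in_cell s (endpoints k) c r = false.
Proof.
case: c => [[[|[|[|//]]] lt_a3] b] //= _.
- by rewrite /in_cell occ_positions_endpoints.
- by rewrite /in_cell occ_positions_endpoints /= ltnNge ltn_ord.
Qed.

Lemma endpoints_occurrence k (p : mesh_pattern 2) (s : 'S_k.+2) :
    {in mesh_shading p, forall c, val c.1 != 1} ->
    (s ord0 < s ord_max) = (mesh_perm p ord0 < mesh_perm p ord_max) ->
  is_occurrence p s (endpoints k).
Proof.
move=> outer_p same_order.
(* Distinct values compare one way or the other, so agreement on one ordered
   pair of positions gives agreement on the reversed pair. *)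
have flip n (t : 'S_n.+2) :
    (t ord_max < t ord0) = ~~ (t ord0 < t ord_max).
  by rewrite -leqNgt ltn_neqAle (inj_eq val_inj) (inj_eq perm_inj).
apply/and3P; split.
- apply/forallP=> i; apply/forallP=> j; rewrite !ffunE.
  by case: (ord2_cases i) => ->; case: (ord2_cases j) => ->.
- apply/forallP=> i; apply/forallP=> j; rewrite !ffunE.
  case: (ord2_cases i) => ->; case: (ord2_cases j) => -> /=;
    by rewrite ?ltnn ?flip ?same_order.
- apply/forall_inP=> c /outer_p c_outer; apply/existsPn=> r.
  by rewrite in_cell_endpoints.
Qed.

Lemma avoids_length1 (p : mesh_pattern 2) (s : 'S_1) : avoids p s.
Proof.
apply/existsPn=> e; apply/negP=> /and3P[/forallP/(_ ord0) + _ _].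
by move/forallP/(_ ord_max); rewrite !ord1.
Qed.

Theorem proposition3p1 :
  [/\ avoiders 1 mesh_A mesh_D = [set: 'S_1],
      [set: 'S_1] = [set 1%g]
    & forall n : nat, 2 <= n -> avoiders n mesh_A mesh_D = set0].
Proof.
split.
- by apply/setP=> s; rewrite !inE !avoids_length1.
- apply/setP=> s; rewrite !inE; apply/esym/eqP/permP=> i.
  by rewrite !ord1.
- case=> [|[|k]] // _; apply/setP=> s; rewrite !inE.
  apply/negP=> /andP[/existsPn avA /existsPn avD].
  have [s_incr | s_decr] := boolP (s ord0 < s ord_max).
  + move/negP: (avA (endpoints k)); apply; apply: endpoints_occurrence.
      by move=> c; rewrite !inE => /orP[] /eqP->.
    by rewrite s_incr /= !perm1.
  + move/negP: (avD (endpoints k)); apply; apply: endpoints_occurrence.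
      by move=> c; rewrite !inE => /orP[] /eqP->.
    by rewrite (negbTE s_decr) /= tpermL tpermR.
Qed.
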